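(* Let $\mathcal{A}\in\mathbb{R}^{[m,n]}$ be a $\mathcal{KS}$-tensor. Then for any $q\in\mathbb{R}^n$, the set of all $x\in\mathbb{R}^n$ satisfying $$x\ge 0,\qquad \mathcal{A}x^{m-1}-q\ge 0,\qquad x^{\top}(\mathcal{A}x^{m-1}-q)=0$$ is nonempty and compact.
   Context: $\mathbb{R}^{[m,n]}$ is the set of real tensors $\mathcal{A}=(a_{i_1\cdots i_m})$ of order $m$ and dimension $n$ (indices in $[n]=\{1,\dots,n\}$). For $x\in\mathbb{R}^n$ (or $\mathbb{C}^n$), $\mathcal{A}x^{m-1}$ is the vector with $i$-th component $(\mathcal{A}x^{m-1})_i=\sum_{i_2,\dots,i_m=1}^n a_{ii_2\cdots i_m}x_{i_2}\cdots x_{i_m}$. Vector inequalities are componentwise. The symbol $\delta_{i_1\cdots i_m}$ equals $1$ if $i_1=\cdots=i_m$ and $0$ otherwise. The identity tensor $\mathcal{I}_m$ has entries $\delta_{i_1\cdots i_m}$. A tensor is non-negative if every entry is $\ge 0$. $\mathcal{A}$ is a $\mathcal{P}$-tensor if for each nonzero $x\in\mathbb{R}^n$ there exists $i\in[n]$ such that $x_i(\mathcal{A}x^{m-1})_i>0$. The spectral radius $\rho(\mathcal{B})$ is the maximum modulus of the eigenvalues of $\mathcal{B}$, i.e. of the $\lambda\in\mathbb{C}$ for which there is a nonzero $x\in\mathbb{C}^n$ with $(\mathcal{B}x^{m-1})_i=\lambda x_i^{m-1}$ for all $i$. A tensor is a nonsingular (strong) $\mathcal{M}$-tensor if it can be written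 as $s\mathcal{I}_m-\mathcal{B}$ with $\mathcal{B}$ non-negative and $s>\rho(\mathcal{B})$. $\mathcal{KS}$-tensor: let $\mathcal{A}=(a_{i_1\cdots i_m})\in\mathbb{R}^{[m,n]}$ be a $\mathcal{P}$-tensor, and let $\mathcal{W}=(w_{i_1\cdots i_m})$ have entries $w_{i_1\cdots i_m}=a_{i_1\cdots i_m}$ if $i_1=\cdots=i_m$; $w_{i_1\cdots i_m}=0$ if $\delta_{i_1\cdots i_m}=0$ and $a_{i_1\cdots i_m}>0$; $w_{i_1\cdots i_m}=a_{i_1\cdots i_m}$ if $\delta_{i_1\cdots i_m}=0$ and $a_{i_1\cdots i_m}\le 0$. If $\mathcal{W}$ is a nonsingular (strong) $\mathcal{M}$-tensor, then $\mathcal{A}$ is called a $\mathcal{KS}$-tensor. *)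

(* Defs.v *)
From HB Require Import structures.
From mathcomp Require Import all_boot all_order all_algebra.
From mathcomp Require Import all_classical all_reals all_analysis.
From mathcomp Require Import complex.
Set Implicit Arguments.
Unset Strict Implicit.
Unset Printing Implicit Defensive.
Import Order.TTheory GRing.Theory Num.Theory.
Import numFieldNormedType.Exports.

Local Open Scope classical_set_scope.
Local Open Scope ring_scope.

(* The entry a_{i_1 ... i_m} is [A [tuple i_1; ...; i_m]]. *)
Notation tensor K m n := {ffun m.-tuple 'I_n -> K}.

(* A x^{m-1}; the sum ranges over the index tuples whose first index is i. *)
Definition tensor_apply (K : comNzRingType) (m n : nat)
    (A : tensor K m n) (x : 'rV[K]_n) : 'rV[K]_n :=
  \row_i \sum_(t : m.-tuple 'I_n | ohead t == Some i)
    A t * \prod_(j <- behead t) x 0 j.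

(* [constant t] says that all entries of t are equal. *)
Definition id_tensor (K : comNzRingType) (m n : nat) : tensor K m n :=
  [ffun t : m.-tuple 'I_n => (constant t)%:R].

Definition nonneg_tensor (R : realType) (m n : nat) (A : tensor R m n) : Prop :=
  forall t, 0 <= A t.

Definition P_tensor (R : realType) (m n : nat) (A : tensor R m n) : Prop :=
  forall x : 'rV[R]_n, x != 0 ->
    exists i, 0 < x 0 i * tensor_apply A x 0 i.

Definition complex_tensor (R : realType) (m n : nat) (A : tensor R m n) :
    tensor (complex R) m n :=
  [ffun t => real_complex R (A t)].

Definition tensor_eigenvalue (R : realType) (m n : nat) (A : tensor R m n)
    (lambda : complex R) : Prop :=
  exists2 x : 'rV[complex R]_n, x != 0 &
    forall i, tensor_apply (complex_tensor A) x 0 i = lambda * x 0 i ^+ m.-1.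

(* For m >= 2 and n >= 1 the set of eigenvalues is finite and nonempty, so this
   supremum is a maximum. *)
Definition spectral_radius (R : realType) (m n : nat) (A : tensor R m n) : R :=
  sup [set ComplexField.Normc.normc lambda | lambda in tensor_eigenvalue A].

Definition strong_M_tensor (R : realType) (m n : nat) (A : tensor R m n) :
    Prop :=
  exists (s : R) (B : tensor R m n),
    [/\ nonneg_tensor B, spectral_radius B < s & A = s *: id_tensor R m n - B].

(* The tensor W obtained from A by replacing its positive off-diagonal entries
   by 0. *)
Definition M_part (R : realType) (m n : nat) (A : tensor R m n) :
    tensor R m n :=
  [ffun t : m.-tuple 'I_n =>
    if constant t then A t else if 0 < A t then 0 else A t].

Definition KS_tensor (R : realType) (m n : nat) (A : tensor R m n) : Prop :=
  P_tensor A /\ strong_M_tensor (M_part A).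

Definition TCP_solutions (R : realType) (m n : nat) (A : tensor R m n)
    (q : 'rV[R]_n) : set 'rV[R]_n :=
  [set x : 'rV[R]_n |
    [/\ (forall i, 0 <= x 0 i),
        (forall i, 0 <= (tensor_apply A x - q) 0 i) &
        \sum_i x 0 i * (tensor_apply A x - q) 0 i = 0]].

(* Main.v *)
Require Import Defs.
From HB Require Import structures.
From mathcomp Require Import all_boot all_order all_algebra.
From mathcomp Require Import fingroup perm.
From mathcomp Require Import all_classical all_reals all_analysis.
From mathcomp Require Import complex.
Import Order.TTheory GRing.Theory Num.Theory.
Import numFieldNormedType.Exports.
Local Open Scope classical_set_scope.
Local Open Scope ring_scope.

(** Write F x for A x^(m-1), a continuous map whose coordinates are
    homogeneous of degree m - 1. On the unit sphere the P property and
    compactness bound the largest of the products x_i F_i(x) away from 0;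
    scaling gives a constant c > 0 such that every x <> 0 has an index i with
    c |x|^m <= x_i F_i(x) ([P_tensor_coercive]). If moreover
    x_i (F_i(x) - q_i) <= 0 for all i, then c |x|^m <= x_i q_i <= |x| |q| for
    such an i, and since m > 1 this bounds |x| by a constant K
    ([P_tensor_a_priori_bound]). All solutions of the complementarity problem
    satisfy these inequalities, so the solution set is bounded; being defined
    by weak inequalities between continuous functions it is closed, hence
    compact.

    For existence, the complementarity problem is first truncated to a box
    [0, M]^n with M > K: there is an x in the box such that F_i(x) - q_i is
    nonpositive where x_i > 0 and nonnegative where x_i < M
    ([box_complementarity]). Such an x satisfies the inequalities of the a
    priori bound, so all its coordinates are below M, the upper faces of the
    box are inactive, and x solves the untruncated problem.

    The box problem is a form of Brouwer's theorem. It is deduced from Kuhn's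
    combinatorial lemma ([kuhn_cube_lemma]): if the points of the grid
    {0, ..., p}^n carry n binary labels such that the i-th label is 0 on the
    face x_i = 0 and 1 on the face x_i = p, then some unit cell meets both
    values of every label. Labelling a point by the signs of the coordinates
    of F - q and refining the grid, any cluster point of these cells is a
    solution.

    Kuhn's lemma is proved by a mod 2 degree. A binary label f_i is a
    0-cochain with values in F_2 on the grid, triangulated by the monotone
    lattice paths from the lower to the upper corner of each cell; the
    coboundaries of the f_i have a cup product, whose value on a path
    v_0, ..., v_n is the product of the f_i(v_(i+1)) - f_i(v_i). If the sum of
    these values over all paths is nonzero, then some path changes all the
    labels, inside one cell. By Stokes' theorem this sum depends only on the
    boundary values of the labels ([degree_boundary]), and it is 1 for the
    labels given by x_i = p, for which exactly one path contributes
    ([degree_top]). *)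

(** * Leibniz rule for cup products modulo 2 *)

Lemma F2_addrr (x : 'F_2) : x + x = 0.
Proof. exact: (@addrr_pchar2 _ (pchar_Fp (isT : prime 2))). Qed.

(** In this part [a i t] stands for the value of the label f_i at the vertex
    v_t of a path v_0, ..., v_n. [facet_term a k n j] is the cup product
    df_0 u ... u df_(k-1) u f_k u df_(k+1) u ... u df_(n-1), of degree n - 1,
    evaluated on the facet opposite to v_j; the vertices of this facet are the
    v_(bump j t) for t < n. Signs are irrelevant as the values are in F_2. *)
Definition facet_left (a : nat -> nat -> 'F_2) (k j : nat) : 'F_2 :=
  \prod_(0 <= i < k) (a i (bump j i.+1) + a i (bump j i)).

Definition facet_right (a : nat -> nat -> 'F_2) (k n j : nat) : 'F_2 :=
  \prod_(k.+1 <= i < n) (a i (bump j i) + a i (bump j i.-1)).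

Definition facet_term (a : nat -> nat -> 'F_2) (k n j : nat) : 'F_2 :=
  facet_left a k j * a k (bump j k) * facet_right a k n j.

Lemma bump_le j i : (j <= i)%N -> bump j i = i.+1.
Proof. by rewrite /bump => ->. Qed.

Lemma bump_gt j i : (i < j)%N -> bump j i = i.
Proof. by move=> ij; rewrite /bump leqNgt ij. Qed.

(** The coboundary of df_0 u ... u df_(k-1) vanishes; the sum below is that
    coboundary short of its last facet, which is the right-hand side. *)
Lemma sum_facet_left a k :
  \sum_(0 <= j < k.+1) facet_left a k j =
  \prod_(0 <= i < k) (a i i.+1 + a i i).
Proof.
elim: k => [|k IHk]; first by rewrite big_nat1 /facet_left !big_geq.
rewrite big_nat_recr //= [RHS]big_nat_recr //= -IHk.
rewrite (_ : \sum_(0 <= j < k.+1) facet_left a k.+1 j =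
  (\sum_(0 <= j < k.+1) facet_left a k j) * (a k k.+2 + a k k.+1)); last first.
  rewrite big_distrl; apply: eq_big_nat => j /andP[_ jk].
  by rewrite /facet_left big_nat_recr //= !bump_le // ltnW.
rewrite IHk (_ : facet_left a k.+1 k.+1 =
  (\prod_(0 <= i < k) (a i i.+1 + a i i)) * (a k k.+2 + a k k)); last first.
  rewrite /facet_left big_nat_recr //= bump_le // bump_gt //.
  congr (_ * _); apply: eq_big_nat => i /andP[_ ik].
  by rewrite !bump_gt // ltnW.
by rewrite -mulrDr addrACA F2_addrr add0r addrC [a k k + _]addrC addrC.
Qed.

(** The same for df_(k+1) u ... u df_(n-1), whose first facet is the
    missing one. *)
Lemma sum_facet_right a k n : (k < n)%N ->
  \sum_(k.+1 <= j < n.+1) facet_right a k n j =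
  \prod_(k.+1 <= i < n) (a i i.+1 + a i i).
Proof.
elim: n => // n IHn; rewrite ltnS leq_eqVlt => /predU1P[->|kn].
  by rewrite big_nat1 /facet_right !big_geq.
rewrite big_nat_recr //=; last by rewrite ltnW.
rewrite big_nat_recr //= [RHS]big_nat_recr //= -IHn //.
rewrite [in RHS]big_nat_recr //= mulrDl big_distrl.
rewrite -addrA; congr (_ + _).
  apply: eq_big_nat => j /andP[kj jn].
  rewrite /facet_right big_nat_recr //= bump_le 1?ltnW // bump_le ?prednK //.
    by rewrite (leq_ltn_trans _ kn).
  by rewrite -ltnS prednK // (leq_ltn_trans _ kn).
have n0 : (0 < n)%N by rewrite (leq_ltn_trans _ kn).
rewrite /facet_right !big_nat_recr //= [bump n n]bump_le //.
rewrite !bump_gt //; last by rewrite prednK.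
  rewrite (eq_big_nat _ _
   (F1 := fun i => a i (bump n.+1 i) + a i (bump n.+1 i.-1))
   (F2 := fun i => a i (bump n i) + a i (bump n i.-1))).
    by rewrite -mulrDr addrACA F2_addrr addr0.
  move=> i /andP[ki iN].
  have i1 : (i.-1 < n)%N by rewrite (leq_ltn_trans (leq_pred _)).
  by rewrite !bump_gt // ltnW.
by rewrite ltnS leq_pred.
Qed.

(** Leibniz rule: since df_i is closed, the coboundary of the product with
    f_k in position k is the product of all the df_i. *)
Lemma sum_facet_term a k n : (k < n)%N ->
  \sum_(0 <= j < n.+1) facet_term a k n j =
  \prod_(0 <= i < n) (a i i.+1 + a i i).
Proof.
move=> kn; rewrite (big_cat_nat (n := k.+1)) //=; last by rewrite ltnS ltnW.
rewrite (_ : \sum_(0 <= j < k.+1) facet_term a k n j =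
  (\prod_(0 <= i < k) (a i i.+1 + a i i)) * a k k.+1 *
  \prod_(k.+1 <= i < n) (a i i.+1 + a i i)); last first.
  rewrite -sum_facet_left -mulrA big_distrl; apply: eq_big_nat => j /andP[_ jk].
  rewrite /facet_term bump_le // -mulrA; congr (_ * (_ * _)).
  apply: eq_big_nat => i /andP[ki _].
  have jk' : (j <= k)%N by [].
  have ji : (j <= i.-1)%N by rewrite (leq_trans jk') // -ltnS (ltn_predK ki).
  by rewrite !bump_le ?(ltn_predK ki) // (leq_trans ji) ?leq_pred.
rewrite (_ : \sum_(k.+1 <= j < n.+1) facet_term a k n j =
  (\prod_(0 <= i < k) (a i i.+1 + a i i)) * a k k *
  \prod_(k.+1 <= i < n) (a i i.+1 + a i i)); last first.
  rewrite -sum_facet_right // big_distrr; apply: eq_big_nat => j /andP[kj _].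
  rewrite /facet_term bump_gt //; congr (_ * _ * _).
  apply: eq_big_nat => i /andP[_ ik].
  by rewrite !bump_gt // (leq_trans _ kj) // ltnS // ltnW.
rewrite -mulrDl -mulrDr [RHS](big_cat_nat (n := k)) //= ?(ltnW kn) //.
by rewrite [in RHS](big_ltn (m := k)) // mulrA.
Qed.

(** * The mod 2 degree of a labelling of the grid *)

Lemma facet_term_ext {a a' : nat -> nat -> 'F_2} {k n j j' : nat} : (k < n)%N ->
  (forall i t, (t < n)%N -> a i (bump j t) = a' i (bump j' t)) ->
  facet_term a k n j = facet_term a' k n j'.
Proof.
move=> kn aa'; rewrite /facet_term aa' //; congr (_ * _ * _).
  apply: eq_big_nat => i /andP[_ ik].
  by rewrite !aa' // (leq_trans _ kn) // ltnS // ltnW.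
apply: eq_big_nat => i /andP[_ iN].
by rewrite !aa' // (leq_ltn_trans (leq_pred _)).
Qed.

Lemma prod_nat_eq0 {m n} c {F : nat -> 'F_2} : (m <= c < n)%N -> F c = 0 ->
  \prod_(m <= i < n) F i = 0.
Proof.
move=> mcn Fc; rewrite (bigD1_seq c) ?mem_index_iota ?iota_uniq //=.
by rewrite Fc mul0r.
Qed.

(** This covers a facet lying in a face of the grid orthogonal to the axis c:
    there f_k vanishes if c = k, and df_c vanishes otherwise. *)
Lemma facet_term_eq0 {a : nat -> nat -> 'F_2} {k n j} c :
  (k < n)%N -> (c < n)%N ->
  (if c == k then a k (bump j k) = 0
   else forall t t', (t < n)%N -> (t' < n)%N ->
     a c (bump j t) = a c (bump j t')) ->
  facet_term a k n j = 0.
Proof.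
move=> kn cn; rewrite /facet_term.
case: (ltngtP c k) => [ck|kc|_ /= ->]; last first.
- by rewrite mulr0 mul0r.
- move=> H; rewrite (_ : facet_right _ _ _ _ = 0) ?mulr0 //.
  apply: (prod_nat_eq0 c); first by rewrite kc.
  by rewrite (H _ c.-1) ?F2_addrr // (leq_ltn_trans (leq_pred _)).
- move=> H; rewrite (_ : facet_left _ _ _ = 0) ?mul0r //.
  apply: (prod_nat_eq0 c); first by rewrite ck.
  by rewrite (H _ c) ?F2_addrr // (leq_ltn_trans _ kn).
Qed.

(** A monotone path through the cell with lower corner q is coded by the
    permutation s such that the path moves along the axis i at time s i. *)
Definition vertex {n} (q : 'I_n -> nat) (s : 'S_n) (t : nat) : 'I_n -> nat :=
  fun i => (q i + (s i < t))%N.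

Definition cell n p := {ffun 'I_n -> 'I_p}.

Definition corner {n p} (q : cell n p) : 'I_n -> nat := fun i => q i.

Definition labelling n := 'I_n -> ('I_n -> nat) -> 'F_2.

Definition path_values {n} (f : labelling n.+1) q (s : 'S_n.+1) :
    nat -> nat -> 'F_2 :=
  fun i t => f (inord i) (vertex q s t).

Definition path_product {n} (f : labelling n.+1) q (s : 'S_n.+1) : 'F_2 :=
  \prod_i (f i (vertex q s i.+1) + f i (vertex q s i)).

(** The integral of df_0 u ... u df_(n-1) over the triangulated grid. *)
Definition degree {n} p (f : labelling n.+1) : 'F_2 :=
  \sum_(s : 'S_n.+1) \sum_(q : cell n.+1 p) path_product f (corner q) s.

Lemma path_productE {n} (f : labelling n.+1) q (s : 'S_n.+1) :
  path_product f q s =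
  \prod_(0 <= i < n.+1) (path_values f q s i i.+1 + path_values f q s i i).
Proof.
rewrite big_mkord /path_product; apply: eq_bigr => i _.
by rewrite /path_values inord_val.
Qed.

(** Interchanging the moves made at the times j - 1 and j affects no vertex of
    the path but the j-th. *)
Lemma vertex_tperm {n} (q : 'I_n.+1 -> nat) (s : 'S_n.+1) j t :
  (0 < j < n.+1)%N -> t != j ->
  vertex q (s * tperm (inord j.-1) (inord j))%g t = vertex q s t.
Proof.
move=> /andP[j0 jn] tj; apply: funext => i; rewrite /vertex permM.
have j1n : (j.-1 < n.+1)%N by rewrite (leq_ltn_trans (leq_pred _)).
have jt : (j < t)%N = (j.-1 < t)%N.
  by rewrite -[in RHS]ltnS prednK // ltnS [in RHS]leq_eqVlt eq_sym (negPf tj).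
by case: tpermP => [->|->|//]; rewrite !inordK // jt.
Qed.

(** Multiplication by a transposition pairs even with odd permutations. *)
Lemma sum_involution_eq0 {n} (F : 'S_n -> 'F_2) (u v : 'I_n) : u != v ->
  (forall s, F (s * tperm u v)%g = F s) -> \sum_s F s = 0.
Proof.
move=> uv HF; rewrite (bigID (@odd_perm _)) /=.
rewrite (reindex_inj (mulIg (tperm u v))) /=.
rewrite (eq_bigl (fun s : 'S_n => ~~ odd_perm s)); last first.
  by move=> s; rewrite odd_permM odd_tperm uv addbT.
by rewrite (eq_bigr F) ?F2_addrr.
Qed.

(** The facet opposite to an inner vertex v_j is shared by exactly two paths of
    the cell, which differ by the moves at the times j - 1 and j. *)
Lemma sum_inner_facet_eq0 {n p} (f : labelling n.+1) k j :
  (k < n.+1)%N -> (0 < j < n.+1)%N ->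
  \sum_(s : 'S_n.+1) \sum_(q : cell n.+1 p)
    facet_term (path_values f (corner q) s) k n.+1 j = 0.
Proof.
move=> kn jn; apply: (sum_involution_eq0 _ (inord j.-1) (inord j)).
  case/andP: jn => j0 jn.
  rewrite -val_eqE /= !inordK // ?(leq_ltn_trans (leq_pred _)) //.
  by rewrite neq_ltn prednK // leqnn.
move=> s; apply: eq_bigr => q _; apply: facet_term_ext => // i t _.
by rewrite /path_values vertex_tperm // eq_sym neq_bump.
Qed.

(** Dropping the first vertex of a path that starts with a move along the axis
    c gives the same facet as dropping the last vertex of the path of the next
    cell in the direction c that makes the move along c last. This matches the
    end facets except those in the two faces of the grid orthogonal to c, where
    the hypotheses make the facet term vanish. *)
Lemma sum_end_facets_eq {n p} (f : labelling n.+1) (k : 'I_n.+1) :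
  (forall x, (x k == 0) || (x k == p.+1) -> f k x = 0) ->
  (forall c x y, c != k -> x c = y c -> (x c == 0) || (x c == p.+1) ->
     f c x = f c y) ->
  \sum_(s : 'S_n.+1) \sum_(q : cell n.+1 p.+1)
    facet_term (path_values f (corner q) s) k n.+1 0 =
  \sum_(s : 'S_n.+1) \sum_(q : cell n.+1 p.+1)
    facet_term (path_values f (corner q) s) k n.+1 n.+1.
Proof.
move=> fk fc.
(* s * r makes the first move of s last and all the others one step earlier. *)
pose r : 'S_n.+1 := perm (can_inj (@ord_predK _)).
rewrite [RHS](reindex_inj (mulIg r)) /=; apply: eq_bigr => s _.
pose c := (s^-1)%g ord0.
have sc : s c = ord0 by rewrite permKV.
(* The shift to the next cell along c is made cyclic, hence bijective; at the
   wrap-around both facets lie in a face of the grid and contribute 0. *)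
pose up (q : cell n.+1 p.+1) : cell n.+1 p.+1 :=
  [ffun i => if i == c then ordS (q i) else q i].
have upI : injective up.
  move=> q q' /ffunP E; apply/ffunP => i; move: (E i); rewrite !ffunE.
  by case: eqP => // _; apply: can_inj (@ordSK _) _ _.
rewrite [RHS](reindex_inj upI) /=; apply: eq_bigr => q _.
have face_eq0 (q' : cell n.+1 p.+1) s' j x : (x == 0) || (x == p.+1) ->
    (forall t, (t < n.+1)%N -> vertex (corner q') s' (bump j t) c = x) ->
    facet_term (path_values f (corner q') s') k n.+1 j = 0.
  move=> x0p Hx; apply: (facet_term_eq0 c) => //.
  case: eqP => [/val_inj ck|/eqP ck].
    by rewrite /path_values inord_val fk // -ck Hx.
  move=> t t' tn t'n; rewrite /path_values inord_val.
  by apply: fc; rewrite ?Hx // -val_eqE.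
have rs i : i != c -> (r (s i)).+1 = s i :> nat.
  move=> ic; rewrite permE /= -[in RHS](ord_predK (s i)) /=.
  have si0 : (0 < s i)%N.
    by rewrite lt0n -[_ == _]/(s i == ord0) -sc (inj_eq perm_inj).
  have : ((s i + n.+1).-1 %% n.+1 = (s i).-1)%N.
    case: (nat_of_ord (s i)) (ltn_ord (s i)) si0 => // m mn _.
    by rewrite addSn /= modnDr modn_small // ltnW.
  by move=> ->; rewrite prednK // modn_small.
have rc : r (s c) = n :> nat by rewrite permE sc /= modn_small.
case: (eqVneq (nat_of_ord (q c)) p) => qc.
  rewrite (face_eq0 q s 0%N p.+1) ?eqxx ?orbT //; last first.
    by move=> t _; rewrite /vertex sc bump_le //= /corner qc addn1.
  rewrite (face_eq0 (up q) _ n.+1 0%N) //.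
  move=> t tn; rewrite /vertex /corner ffunE eqxx /= qc modnn bump_gt //.
  by rewrite permM rc ltnNge -ltnS tn.
apply: facet_term_ext => // i t tn; rewrite /path_values; congr f.
apply: funext => d; rewrite /vertex /corner ffunE bump_le // bump_gt // permM.
case: (eqVneq d c) => [->|dc]; last by rewrite -(rs d) // ltnS.
rewrite rc sc /= modn_small; first by rewrite addn1 ltnNge -ltnS tn addn0.
by rewrite ltnS ltn_neqAle qc -ltnS ltn_ord.
Qed.

(** Stokes' theorem: the integrand is the coboundary of the cochain summed by
    [facet_term], whose integral over the boundary of the grid is 0. *)
Lemma degree_eq0 {n p} (f : labelling n.+1) (k : 'I_n.+1) :
  (forall x, (x k == 0) || (x k == p.+1) -> f k x = 0) ->
  (forall c x y, c != k -> x c = y c -> (x c == 0) || (x c == p.+1) ->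
     f c x = f c y) ->
  degree p.+1 f = 0.
Proof.
move=> fk fc; rewrite /degree.
under eq_bigr => s _ do under eq_bigr => q _ do
  rewrite path_productE -(sum_facet_term _ k) //.
under eq_bigr => s _ do rewrite exchange_big /=.
rewrite exchange_big /= big_nat_recl // big_nat_recr //=.
rewrite sum_end_facets_eq // [X in _ + X]addrC addrA F2_addrr add0r.
apply: big1_seq => j /andP[_]; rewrite mem_index_iota => /andP[_ jn].
exact: sum_inner_facet_eq0.
Qed.

Definition boundary_labelling {n} p (f : labelling n) :=
  forall i x, (x i == 0%N -> f i x = 0) /\ (x i == p -> f i x = 1).

(** The labels of f are replaced by those of g one at a time. The degree is
    linear in each label, and the difference of the two labels of index k
    vanishes on the faces orthogonal to the axis k, so that [degree_eq0]
    applies. *)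
Lemma degree_boundary {n p} (f g : labelling n.+1) :
  boundary_labelling p.+1 f -> boundary_labelling p.+1 g ->
  degree p.+1 f = degree p.+1 g.
Proof.
move=> bf bg.
pose u m : labelling n.+1 := fun i => if (i < m)%N then g i else f i.
have bu m : boundary_labelling p.+1 (u m).
  by move=> i x; rewrite /u; case: ifP.
have E m : (m <= n.+1)%N -> degree p.+1 (u m) = degree p.+1 f.
  elim: m => [|m IHm] mn; first by congr degree.
  rewrite -IHm ?(ltnW mn) //.
  suff E0 : degree p.+1 (u m) + degree p.+1 (u m.+1) = 0.
    by rewrite -[LHS]add0r -(F2_addrr (degree p.+1 (u m))) -addrA E0 addr0.
  pose k : 'I_n.+1 := Ordinal mn.
  pose w : labelling n.+1 := fun i x =>
    if i == k then f i x + g i x else u m i x.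
  have uw c : c != k -> u m.+1 c = u m c.
    by move=> ck; rewrite /u ltnS leq_eqVlt -[m]/(val k) val_eqE (negPf ck).
  have prodE (v : labelling n.+1) q (s : 'S_n.+1) :
      (forall c, c != k -> v c = u m c) ->
      path_product v q s = (v k (vertex q s k.+1) + v k (vertex q s k)) *
        \prod_(i | i != k) (u m i (vertex q s i.+1) + u m i (vertex q s i)).
    move=> vu; rewrite /path_product (bigD1 k) //=; congr (_ * _).
    by apply: eq_bigr => i ik; rewrite vu.
  rewrite -(_ : degree p.+1 w = 0).
    rewrite /degree -big_split; apply: eq_bigr => s _.
    rewrite -big_split; apply: eq_bigr => q _.
    rewrite (prodE w) => [|c /negPf ck]; last by rewrite /w ck.
    rewrite (prodE (u m)) // (prodE (u m.+1)) // [LHS]/=.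
    rewrite -mulrDl; congr (_ * _).
    by rewrite /w eqxx /u ltnn ltnSn addrACA.
  apply: (degree_eq0 w k) => [x|c x y ck xy].
    rewrite /w eqxx; have [f0 fp] := bf k x; have [g0 gp] := bg k x.
    case/orP => xk; first by rewrite f0 // g0 // addr0.
    by rewrite fp // gp // F2_addrr.
  rewrite /w (negPf ck); have [f0 fp] := bu m c x; have [g0 gp] := bu m c y.
  case/orP => xk; first by rewrite f0 // g0 // -xy.
  by rewrite fp // gp // -xy.
rewrite -(E n.+1) //; congr degree; apply: funext => i.
by rewrite /u ltn_ord.
Qed.

(** * Kuhn's lemma *)

(** The label i changes on a path exactly when the path moves along the axis i
    from p to p + 1, and the path product requires this move at time i: only
    the identity permutation in the last cell contributes. *)
Lemma degree_top {n p} :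
  degree p.+1 (fun (i : 'I_n.+1) x => (x i == p.+1)%:R) = 1.
Proof.
pose f : labelling n.+1 := fun i x => (x i == p.+1)%:R.
have prodE (s : 'S_n.+1) (q : cell n.+1 p.+1) :
    path_product f (corner q) s = ((s == 1%g) && (q == [ffun=> ord_max]))%:R.
  have -> : path_product f (corner q) s =
      \prod_i ((s i == i) && (q i == ord_max))%:R.
    apply: eq_bigr => i _; rewrite /f /vertex /corner ltnS.
    rewrite -!val_eqE /=; have := ltn_ord (q i).
    case: (ltngtP (s i) i) => _ /=; rewrite ?addn1 ?addn0 ?F2_addrr //.
    rewrite eqSS => qp; rewrite (_ : (_ == p.+1) = false) ?addr0 //.
    by rewrite ltn_eqF.
  case: andP => [[/eqP -> /eqP ->]|nsq].
    by rewrite big1 // => i _; rewrite perm1 ffunE !eqxx.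
  have [i ni] : exists i, ~~ ((s i == i) && (q i == ord_max)).
    apply/existsP; rewrite -negb_forall; apply/negP => /forallP H; apply: nsq.
    split; apply/eqP.
      by apply/permP => i; rewrite perm1; case/andP: (H i) => /eqP.
    by apply/ffunP => i; rewrite ffunE; case/andP: (H i) => _ /eqP.
  by rewrite (bigD1 i) //= (negPf ni) mul0r.
rewrite /degree -/f (bigD1 1%g) //= (bigD1 [ffun=> ord_max]) //=.
rewrite prodE !eqxx big1 => [|q /negPf qE]; last by rewrite prodE eqxx qE.
rewrite addr0 big1 ?addr0 // => s /negPf sE.
by rewrite big1 // => q _; rewrite prodE sE.
Qed.

(** The cell is one crossed by a path whose path product is nonzero; for
    n = 0 any cell will do. *)
Lemma kuhn_cube_lemma {n} p (l : 'I_n -> ('I_n -> nat) -> bool) :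
  (forall i x, x i = 0%N -> l i x = false) ->
  (forall i x, x i = p.+1 -> l i x = true) ->
  exists q : 'I_n -> nat, (forall i, (q i <= p)%N) /\
    forall i b, exists2 x, l i x = b & forall j, (q j <= x j <= (q j).+1)%N.
Proof.
case: n l => [|n] l l0 lp; first by exists (fun=> 0%N); split; case.
pose f : labelling n.+1 := fun i x => (l i x)%:R.
have fE : degree p.+1 f = 1.
  rewrite -(@degree_top n p); apply: degree_boundary => i x; split => /eqP xi.
  - by rewrite /f l0.
  - by rewrite /f lp.
  - by rewrite xi.
  - by rewrite xi eqxx.
have [s [q fsq]] : exists s (q : cell n.+1 p.+1),
    path_product f (corner q) s != 0.
  apply: contrapT => N; move: (oner_neq0 'F_2); rewrite -fE /degree.
  rewrite big1 ?eqxx // => s _; rewrite big1 // => q _.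
  by apply: contrapT => /eqP H; apply: N; exists s, q.
exists (corner q); split=> [i|i b]; first by rewrite -ltnS ltn_ord.
have fi : f i (vertex (corner q) s i.+1) + f i (vertex (corner q) s i) != 0.
  by apply: contraNneq fsq => fi; rewrite /path_product (bigD1 i) //= fi mul0r.
have vq t j : (corner q j <= vertex (corner q) s t j <= (corner q j).+1)%N.
  by rewrite /vertex leq_addr /= -[X in (_ <= X)%N]addn1 leq_add2l leq_b1.
case: (eqVneq (l i (vertex (corner q) s i)) b) => [|lb].
  by exists (vertex (corner q) s i).
exists (vertex (corner q) s i.+1) => //.
move: fi lb; rewrite /f; case: (l i _); case: (l i _); case: b;
  by rewrite ?F2_addrr ?eqxx.
Qed.

(** * Complementarity on a box *)

(** On the grid of mesh M / (p + 1), label i is 1 where G_i > 0, except that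
    the two faces orthogonal to the axis i carry the values that Kuhn's lemma
    prescribes. A vertex with label 0 that is off the face x_i = 0 thus has
    G_i <= 0, and a vertex with label 1 that is off the face x_i = M has
    G_i > 0. *)
Lemma approx_box_complementarity {R : realType} {n} (M : R)
    (G : 'I_n -> 'rV[R]_n -> R) (p : nat) : 0 < M ->
  exists z : 'rV[R]_n, (forall i, 0 <= z 0 i <= M) /\
    forall i,
      (exists2 y : 'rV[R]_n, (forall j, `|z 0 j - y 0 j| <= M / p.+1%:R) &
                  (0 < y 0 i -> G i y <= 0)) /\
      (exists2 y : 'rV[R]_n, (forall j, `|z 0 j - y 0 j| <= M / p.+1%:R) &
                  (y 0 i < M -> 0 < G i y)).
Proof.
move=> M0; pose h := M / p.+1%:R.
have h0 : 0 < h by rewrite divr_gt0.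
pose grid (a : 'I_n -> nat) : 'rV[R]_n := \row_j (h * (a j)%:R).
have gridp a i : a i = p.+1 -> grid a 0 i = M.
  by move=> ai; rewrite mxE ai divfK // pnatr_eq0.
pose l i a := (a i == p.+1) || ((a i != 0%N) && (0 < G i (grid a))).
have [i a ai|i a ai|q [qp ql]] := @kuhn_cube_lemma n p l.
- by rewrite /l ai.
- by rewrite /l ai eqxx.
have close a : (forall j, (q j <= a j <= (q j).+1)%N) ->
    forall j, `|grid q 0 j - grid a 0 j| <= h.
  move=> qa j; rewrite !mxE -mulrBr normrM gtr0_norm // (ler_piMr (ltW h0)) //.
  case/andP: (qa j) => qj aj; rewrite distrC ger0_norm ?subr_ge0 ?ler_nat //.
  by rewrite lerBlDl natr1 ler_nat.
exists (grid q); split => i; first rewrite mxE (mulr_ge0 (ltW h0)) //=.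
  rewrite -[leRHS](gridp (fun=> p.+1) i erefl) mxE (ler_wpM2l (ltW h0)) //.
  by rewrite ler_nat leqW.
split.
- have [a la /close qa] := ql i false; exists (grid a) => //.
  move: la; rewrite /l => /norP[_]; rewrite negb_and negbK mxE -leNgt.
  by case/orP => [/eqP ->|//]; rewrite mulr0 ltxx.
- have [a la /close qa] := ql i true; exists (grid a) => //.
  move: la; rewrite /l => /orP[/eqP /gridp ->|/andP[] //].
  by rewrite ltxx.
Qed.

(** The point is a cluster point of the approximate solutions. If x_i > 0 and
    G_i x > 0, both inequalities hold near x, in particular at a point where
    the approximate solutions guarantee that one of them fails; the upper
    bound is handled in the same way. *)
Lemma box_complementarity {R : realType} {n} (M : R)
    (G : 'I_n -> 'rV[R]_n -> R) : 0 < M -> (forall i, continuous (G i)) ->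
  exists x : 'rV[R]_n, forall i,
    [/\ 0 <= x 0 i <= M, 0 < x 0 i -> G i x <= 0 & x 0 i < M -> 0 <= G i x].
Proof.
move=> M0 cG.
have [z zP] := choice (fun p => approx_box_complementarity M G p M0).
pose box := [set x : 'rV[R]_n | forall i, `[0, M]%classic (x 0 i)].
have cbox : compact box.
  apply: (@rV_compact R n (fun=> `[0, M]%classic)) => _.
  exact: segment_compact.
have zbox : (z @ \oo) box.
  by exists 0%N => // p _ i; rewrite /= in_itv /=; exact: (zP p).1.
have [x [xbox xz]] := cbox (z @ \oo) _ zbox.
have ev (P : set 'rV[R]_n) : nbhs x P -> exists p, forall y : 'rV[R]_n,
    (forall j, `|z p 0 j - y 0 j| <= M / p.+1%:R) -> P y.
  move=> /nbhs_ballP[e /= e0 eP].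
  have e20 : 0 < e / 2 by rewrite divr_gt0.
  have zN : (z @ \oo) [set y | exists2 p, M / p.+1%:R < e / 2 & y = z p].
    exists (Num.trunc (M / (e / 2))) => // p /= Np; exists p => //.
    rewrite ltr_pdivrMr // mulrC -ltr_pdivrMr //.
    by rewrite (lt_le_trans (truncnS_gt _)) // ler_nat ltnS.
  have [_ [[p pe ->] [_ zxp]]] := xz _ _ zN (nbhsx_ballx x _ e20).
  exists p => y yz; apply: eP; split=> // i j; rewrite !ord1.
  rewrite [e]splitr; apply: ball_triangle (zxp 0 j) _.
  exact: le_lt_trans (yz j) pe.
exists x => i; have := xbox i; rewrite /= in_itv /= => xi; split => //.
- move=> x0; rewrite leNgt; apply/negP => Gx.
  have [|p pP] := ev ([set y : 'rV[R]_n | 0 < y 0 i] `&` [set y | 0 < G i y]).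
    apply: filterI.
      exact: (@coord_continuous R 1 n 0 i x _ (lt_nbhsr x0)).
    exact: (cG i x _ (lt_nbhsr Gx)).
  have [_ /(_ i)[[y /pP[/= y0 Gy] yG] _]] := zP p.
  by have := yG y0; rewrite leNgt Gy.
- move=> xM; rewrite leNgt; apply/negP => Gx.
  have [|p pP] := ev ([set y : 'rV[R]_n | y 0 i < M] `&` [set y | G i y < 0]).
    apply: filterI.
      exact: (@coord_continuous R 1 n 0 i x _ (lt_nbhsl xM)).
    exact: (cG i x _ (lt_nbhsl Gx)).
  have [_ /(_ i)[_ [y /pP[/= y0 Gy] yG]]] := zP p.
  by have := yG y0; rewrite ltNge ltW.
Qed.

(** * Tensor complementarity *)

Lemma tensor_apply_continuous {R : realType} {m n} (A : tensor R m n)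
    (i : 'I_n) :
  continuous (fun x : 'rV[R]_n => tensor_apply A x 0 i).
Proof.
rewrite (_ : (fun x => _) = fun x : 'rV[R]_n =>
  \sum_(t : m.-tuple 'I_n | ohead t == Some i)
    A t * \prod_(j <- behead t) x 0 j); last by apply: funext => x; rewrite mxE.
apply: continuous_big => [|t _ x]; first exact: add_continuous.
apply: continuousM; first exact: cst_continuous.
move: x; apply: continuous_big => [|j _]; first exact: mul_continuous.
exact: coord_continuous.
Qed.

Lemma tensor_applyZ {R : realType} {m n} (A : tensor R m n) (c : R) x :
  tensor_apply A (c *: x) = c ^+ m.-1 *: tensor_apply A x.
Proof.
apply/rowP => i; rewrite !mxE mulr_sumr; apply: eq_bigr => t _.
rewrite mulrCA; congr (_ * _).
under eq_bigr => j _ do rewrite mxE.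
rewrite big_split /= big_const_seq count_predT iter_mulr_1.
by rewrite size_behead size_tuple.
Qed.

(** In order at most 1 the map A x^(m-1) does not depend on x, while the P
    property at e_k and at - e_k forces its k-th coordinate to be positive and
    negative. *)
Lemma P_tensor_order_gt1 {R : realType} {m n} (A : tensor R m n) :
  P_tensor A -> 'I_n -> (1 < m)%N.
Proof.
move=> PA k; rewrite ltnNge; apply/negP => m1.
have Ac (x : 'rV[R]_n) : tensor_apply A (- x) = tensor_apply A x.
  rewrite -scaleN1r tensor_applyZ (_ : m.-1 = 0%N) ?scale1r //.
  by case: m m1 {A PA} => [|[]].
have kk : delta_mx 0 k != 0 :> 'rV[R]_n.
  by apply/eqP => /rowP/(_ k)/eqP; rewrite !mxE !eqxx oner_eq0.
case: (PA _ kk) => i.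
have [|j] := PA (- delta_mx 0 k); first by rewrite oppr_eq0.
rewrite Ac !mxE /=; case: eqVneq => [->|_]; last by rewrite oppr0 mul0r ltxx.
case: eqVneq => [->|_]; last by rewrite mul0r ltxx.
by rewrite mulN1r mul1r oppr_gt0 => /ltW; rewrite leNgt => /negPf ->.
Qed.

(** The sum phi of the numbers |v_i| + v_i, where v_i = x_i (A x^(m-1))_i, is
    continuous and positive on the unit sphere, hence at least some positive
    constant there. If all the v_i were below c, phi would be at most 2 n c,
    which the choice of c keeps below that constant. *)
Lemma P_tensor_coercive {R : realType} {m n} (A : tensor R m n) : P_tensor A ->
  exists2 c : R, 0 < c & forall x : 'rV[R]_n, x != 0 ->
    exists i, c * `|x| ^+ m <= x 0 i * tensor_apply A x 0 i.
Proof.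
move=> PA.
pose v (x : 'rV[R]_n) i := x 0 i * tensor_apply A x 0 i.
have cv i : continuous (v ^~ i).
  move=> x; apply: continuousM; first exact: coord_continuous.
  exact: tensor_apply_continuous.
pose phi (x : 'rV[R]_n) := \sum_i (`|v x i| + v x i).
have cphi : continuous phi.
  apply: continuous_big => [|i _ x]; first exact: add_continuous.
  have cn : continuous (fun x => `|v x i|).
    by move=> z; apply: (cvg_norm (cv i z)).
  apply: (@continuousD R _ _ (fun x => `|v x i|) (v^~ i) x); first exact: cn.
  exact: cv.
pose S := [set x : 'rV[R]_n | `|x| = 1].
have unit_sphere (x : 'rV[R]_n) : x != 0 -> S (`|x|^-1 *: x).
  by move=> x0; rewrite /S /= normrZ normfV normr_id mulVf // normr_eq0.
have cS : compact S.
  apply: bounded_closed_compact.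
    by exists 1; split => // M M1 x /= ->; exact: ltW.
  exact: (preimage_closed (fun x _ => @norm_continuous _ _ x) (@closed_eq R 1)).
have [S0|S0] := pselect (S !=set0); last first.
  exists 1 => // x /unit_sphere Sx; exfalso.
  by apply: S0; exists (`|x|^-1 *: x).
have [x0] := compact_EVT_min S0 cS (continuous_subspaceT cphi).
rewrite inE => Sx0 minx0.
have phi0 : 0 < phi x0.
  have [|i xi] := PA x0; first by rewrite -normr_eq0 Sx0 oner_eq0.
  rewrite /phi (bigD1 i) //= ltr_pwDl ?ltr_wpDl ?normr_ge0 //.
  by apply: sumr_ge0 => j _; rewrite -lerBlDr sub0r -normrN ler_norm.
pose c := phi x0 / 2 / n.+1%:R.
have c0 : 0 < c by rewrite !divr_gt0.
exists c => // x nx0.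
set y := `|x|^-1 *: x.
have [i yi] : exists i, c <= y 0 i * tensor_apply A y 0 i.
  apply: contrapT => N.
  have : phi x0 <= phi y by apply: minx0; rewrite inE; exact: unit_sphere.
  apply/negP; rewrite -ltNge.
  apply: (@le_lt_trans _ _ (\sum_(i < n) (c + c))).
    apply: ler_sum => i _.
    have vc : v y i <= c.
      by rewrite leNgt; apply/negP => ci; apply: N; exists i; exact: ltW.
    case: (leP 0 (v y i)) => [v0|/ltW v0]; first by rewrite ger0_norm // lerD.
    by rewrite ler0_norm // addNr addr_ge0 ?ltW.
  rewrite sumr_const card_ord /c -mulrDl -splitr -mulrnAl ltr_pdivrMr //.
  by rewrite -mulr_natr ltr_pM2l // ltr_nat.
exists i; have m0 : (0 < m)%N by rewrite ltnW // (P_tensor_order_gt1 A PA i).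
have nx : 0 < `|x| by rewrite normr_gt0.
rewrite -ler_pdivlMr ?exprn_gt0 //; apply: (le_trans yi).
have -> : (`|x| ^+ m)^-1 = `|x|^-1 * `|x|^-1 ^+ m.-1.
  by rewrite -exprS prednK // exprVn.
by rewrite /y tensor_applyZ !mxE mulrACA [leRHS]mulrC.
Qed.

Lemma coord_le_norm {R : realType} {n} (x : 'rV[R]_n) i : `|x 0 i| <= `|x|.
Proof. by rewrite [leRHS]mx_normrE; exact: (le_bigmax _ _ (0, i)). Qed.

(** The hypothesis on x is satisfied both by the solutions of the
    complementarity problem and by the points that solve its truncation to a
    box. *)
Lemma P_tensor_a_priori_bound {R : realType} {m n} (A : tensor R m n)
    (q : 'rV[R]_n) :
  P_tensor A -> exists K : R, forall x : 'rV[R]_n,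
    (forall i, x 0 i * (tensor_apply A x - q) 0 i <= 0) -> `|x| <= K.
Proof.
move=> PA; have [c c0 cP] := P_tensor_coercive A PA.
exists (Num.max 1 (`|q| / c)) => x xq; rewrite le_max.
case: (leP `|x| 1) => //= x1.
have x0 : x != 0 by rewrite -normr_gt0 (lt_trans ltr01).
have [i xi] := cP x x0; have m1 := P_tensor_order_gt1 A PA i.
have {}xi : c * `|x| ^+ m <= `|x| * `|q|.
  apply: (le_trans xi); move: (xq i); rewrite !mxE mulrBr subr_le0.
  move=> /le_trans; apply; apply: (le_trans (ler_norm _)).
  by rewrite normrM ler_pM // coord_le_norm.
rewrite ler_pdivlMr // -(ler_pM2l (lt_trans ltr01 x1)).
apply: le_trans xi; rewrite mulrA mulrC ler_pM2l // -expr2.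
by rewrite ler_weXn2l // ltW.
Qed.

Lemma tensor_apply_subr_continuous {R : realType} {m n} (A : tensor R m n)
    (q : 'rV[R]_n) (i : 'I_n) :
  continuous (fun x : 'rV[R]_n => (tensor_apply A x - q) 0 i).
Proof.
rewrite (_ : (fun x => _) = fun x => tensor_apply A x 0 i + (- q) 0 i).
  move=> x.
  apply: (@continuousD R _ _ (fun y => tensor_apply A y 0 i) (cst _) x).
    exact: tensor_apply_continuous.
  exact: cst_continuous.
by apply: funext => x; rewrite [LHS]mxE.
Qed.

Lemma TCP_solutions_closed {R : realType} {m n} (A : tensor R m n)
    (q : 'rV[R]_n) : closed (TCP_solutions A q).
Proof.
have cG := tensor_apply_subr_continuous A q.
rewrite (_ : TCP_solutions A q =
  (\bigcap_i [set x : 'rV[R]_n | 0 <= x 0 i]) `&`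
  (\bigcap_i [set x | 0 <= (tensor_apply A x - q) 0 i]) `&`
  [set x : 'rV[R]_n | \sum_i x 0 i * (tensor_apply A x - q) 0 i = 0]);
  last first.
  apply/seteqP; split => x /=.
    by case=> x0 G0 s0; split=> //; split=> i _; [exact: x0|exact: G0].
  by case=> -[x0 G0] s0; split => // i; [exact: x0|exact: G0].
apply: closedI; first apply: closedI.
- apply: closed_bigI => i _.
  exact: (preimage_closed (fun x _ => @coord_continuous R 1 n 0 i x)
    (@closed_ge R 0)).
- apply: closed_bigI => i _.
  exact: (preimage_closed (fun x _ => cG i x) (@closed_ge R 0)).
- have cs : continuous
      (fun x : 'rV[R]_n => \sum_i x 0 i * (tensor_apply A x - q) 0 i).
    apply: continuous_big => [|i _ x]; first exact: add_continuous.
    by apply: continuousM; [exact: coord_continuous|exact: cG].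
  exact: (preimage_closed (fun x _ => cs x) (@closed_eq R 0)).
Qed.

Lemma P_tensor_TCP_compact {R : realType} {m n} (A : tensor R m n)
    (q : 'rV[R]_n) : P_tensor A -> compact (TCP_solutions A q).
Proof.
move=> PA; have [K KP] := P_tensor_a_priori_bound A q PA.
apply: bounded_closed_compact; last exact: TCP_solutions_closed.
exists K; split; first exact: num_real.
move=> M KM x [x0 G0 sum0]; apply: (le_trans _ (ltW KM)); apply: KP => i.
by rewrite (psumr_eq0P _ sum0) // => j _; rewrite mulr_ge0.
Qed.

(** A solution of the problem truncated to a box larger than the a priori bound
    stays off the upper faces of the box. *)
Lemma P_tensor_TCP_nonempty {R : realType} {m n} (A : tensor R m n)
    (q : 'rV[R]_n) : P_tensor A -> TCP_solutions A q !=set0.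
Proof.
move=> PA; have [K KP] := P_tensor_a_priori_bound A q PA.
pose M := Num.max 0 K + 1.
have M0 : 0 < M by rewrite ltr_pwDr // le_max lexx.
have [x xP] := box_complementarity M _ M0 (tensor_apply_subr_continuous A q).
have xG i : x 0 i * (tensor_apply A x - q) 0 i <= 0.
  have [/andP[xi0 _] xG _] := xP i.
  move: xi0; rewrite le_eqVlt => /predU1P[<-|xi0]; first by rewrite mul0r.
  by rewrite mulr_ge0_le0 ?xG // ltW.
have G0 i : 0 <= (tensor_apply A x - q) 0 i.
  have [_ _] := xP i; apply; apply: (le_lt_trans (ler_norm _)).
  apply: (le_lt_trans (coord_le_norm x i)); apply: (le_lt_trans (KP x xG)).
  by rewrite ltr_pwDr // le_max lexx orbT.
exists x; split => // [i|]; first by case: (xP i) => /andP[].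
apply: big1 => i _; apply/eqP; rewrite eq_le xG mulr_ge0 //.
by case: (xP i) => /andP[].
Qed.

Theorem theorem3p1 (R : realType) (m n : nat) (A : tensor R m n)
    (hA : KS_tensor A) (q : 'rV[R]_n) :
  TCP_solutions A q !=set0 /\ compact (TCP_solutions A q).
Proof.
case: hA => PA _.
by split; [exact: P_tensor_TCP_nonempty|exact: P_tensor_TCP_compact].
Qed.
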